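(* Let $f\colon X\to X$ be a continuum-wise hyperbolic homeomorphism of a compact metric space $(X,d)$. Then $f$ satisfies the L-shadowing property.
   Context: Let $f$ be a homeomorphism of a compact metric space $(X,d)$. For $c>0$ and $x\in X$ put $W^s_c(x)=\{y\in X: d(f^n(x),f^n(y))\le c \text{ for all } n\ge 0\}$ and $W^u_c(x)=\{y\in X: d(f^{-n}(x),f^{-n}(y))\le c \text{ for all } n\ge 0\}$. Let $C^s_c(x)$ (resp. $C^u_c(x)$) be the connected component of $W^s_c(x)$ (resp. $W^u_c(x)$) containing $x$. $f$ is cw-expansive (continuum-wise expansive) if there is $c>0$ such that $W^u_c(x)\cap W^s_c(x)$ is totally disconnected for every $x\in X$. $f$ satisfies the cw-local-product-structure if for each $\varepsilon>0$ there is $\delta>0$ such that $C^s_\varepsilon(x)\cap C^u_\varepsilon(y)\ne\emptyset$ whenever $d(x,y)<\delta$. $f$ is continuum-wise hyperbolic (cw-hyperbolic) if it is cw-expansive and satisfies the cw-local-product-structure. Standing convention: whenever $f$ is said to be cw-hyperbolic, $X$ is assumed to be a Peano continuum (compact, connected, locally connected metric space). $f$ satisfies the L-shadowing property if for every $\varepsilon>0$ there is $\delta>0$ such that for every sequence $(x_k)_{k\in\mathbb{Z}}\subset X$ with $d(f(x_k),x_{k+1})\le\delta$ for all $k\in\mathbb{Z}$ and $d(f(x_k),x_{k+1})\to 0$ as $|k|\to\infty$, there is $z\in X$ with $d(f^k(z),x_k)\le\varepsilon$ for all $k\in\mathbb{Z}$ and $d(f^k(z),x_k)\to 0$ as $|k|\to\infty$.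 *)

(* Defs.v *)
From HB Require Import structures.
From mathcomp Require Import all_boot all_order all_algebra.
From mathcomp Require Import all_classical all_reals.
From mathcomp Require Import topology normedtype.

Set Implicit Arguments.
Unset Strict Implicit.
Unset Printing Implicit Defensive.

Import Order.TTheory GRing.Theory Num.Theory.
Import numFieldTopology.Exports.

Local Open Scope classical_set_scope.
Local Open Scope ring_scope.

Record homeomorphism (X : topologicalType) := Homeomorphism {
  homeo_fun :> X -> X;
  homeo_inv : X -> X;
  homeo_funK : cancel homeo_fun homeo_inv;
  homeo_invK : cancel homeo_inv homeo_fun;
  homeo_fun_continuous : continuous homeo_fun;
  homeo_inv_continuous : continuous homeo_inv }.

(* [Negz n] is the integer - (n + 1). *)
Definition homeo_iter (X : topologicalType) (f : homeomorphism X) (k : int) :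
    X -> X :=
  match k with
  | Posz n => iter n f
  | Negz n => iter n.+1 (homeo_inv f)
  end.

Definition locally_connected (X : topologicalType) :=
  forall (x : X) (U : set X), nbhs x U ->
    exists V : set X, [/\ open_nbhs x V, connected V & V `<=` U].

(* The library's [connected] holds of the empty set, so the empty space is
   not excluded here. *)
Definition peano_continuum (X : topologicalType) :=
  [/\ compact [set: X], connected [set: X] & locally_connected X].

Definition stable_set (R : realType) (X : metricType R) (f : homeomorphism X)
    (c : R) (x : X) : set X :=
  [set y | forall n : nat, mdist (iter n f x) (iter n f y) <= c].

Definition unstable_set (R : realType) (X : metricType R) (f : homeomorphism X)
    (c : R) (x : X) : set X :=
  [set y | forall n : nat,
     mdist (iter n (homeo_inv f) x) (iter n (homeo_inv f) y) <= c].

Definition stable_continuum (R : realType) (X : metricType R)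
    (f : homeomorphism X) (c : R) (x : X) : set X :=
  connected_component (stable_set f c x) x.

Definition unstable_continuum (R : realType) (X : metricType R)
    (f : homeomorphism X) (c : R) (x : X) : set X :=
  connected_component (unstable_set f c x) x.

Definition cw_expansive (R : realType) (X : metricType R)
    (f : homeomorphism X) :=
  exists2 c : R, 0 < c &
    forall x : X, totally_disconnected (unstable_set f c x `&` stable_set f c x).

Definition cw_local_product_structure (R : realType) (X : metricType R)
    (f : homeomorphism X) :=
  forall e : R, 0 < e -> exists2 delta : R, 0 < delta &
    forall x y : X, mdist x y < delta ->
      stable_continuum f e x `&` unstable_continuum f e y !=set0.

Definition cw_hyperbolic (R : realType) (X : metricType R)
    (f : homeomorphism X) :=
  [/\ peano_continuum X, cw_expansive f & cw_local_product_structure f].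

(* The filter "|k| tends to infinity" on the integers. *)
Definition absz_infty : set_system int :=
  filter_from [set: nat] (fun N => [set k : int | (N <= `|k|)%N]).

Global Instance absz_infty_filter : ProperFilter absz_infty.
Proof.
apply: filter_from_proper.
  apply: filter_from_filter; first by exists 0%N.
  move=> M N _ _; exists (maxn M N) => // k /=.
  by rewrite geq_max => /andP[].
by move=> N _; exists N%:Z => /=.
Qed.

Definition L_shadowing (R : realType) (X : metricType R)
    (f : homeomorphism X) :=
  forall e : R, 0 < e -> exists2 delta : R, 0 < delta &
    forall x : int -> X,
      (forall k : int, mdist (f (x k)) (x (k + 1)) <= delta) ->
      mdist (f (x k)) (x (k + 1)) @[k --> absz_infty] --> (0 : R) ->
      exists z : X,
        (forall k : int, mdist (homeo_iter f k z) (x k) <= e) /\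
        mdist (homeo_iter f k z) (x k) @[k --> absz_infty] --> (0 : R).

(* Main.v *)
Require Import Defs.
From mathcomp Require Import all_boot all_order all_algebra.
From mathcomp Require Import all_classical all_reals.
From mathcomp Require Import topology normedtype.
From mathcomp Require Import lra.

(** Write W^s_a, W^u_a for the local stable and unstable sets and C^s_a(x),
    C^u_a(x) for the connected components of x in them.

    Expansiveness makes these components contract.  If
    connected sets E_N of diameter bounded below had all their iterates of
    order at least -N within c of a base point, a limit of the E_N would be a
    nondegenerate connected set in the intersection of W^s_c and W^u_c at one
    point, which is totally disconnected ([cw_expansive_small_continua]).
    Since f^n C^s_c(x) is such a set for n >= N, for every a > 0 there is N
    with f^n C^s_c(x) contained in C^s_a(f^n x) for all x and all n >= N
    ([cw_expansive_stable_contraction]); the inverse of f gives the same for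
    the C^u.  Keeping components, and not only points, in this conclusion is
    what makes it composable: two components that share a point add up to a
    connected set, so C^u_a chained with C^u_a lies in C^u_(a+a), and when
    a + a <= c this contracts back into C^u_a.

    With this, Bowen's construction of shadowing points works although the
    intersection of C^s_a(x) and C^u_a(y) may have many points
    ([forward_shadowing]).  Over blocks of a fixed length N one picks y_(i+1)
    in both C^s_a(u_((i+1)N)) and C^u_a(f^N y_i); pulling y_r back, a downward
    induction keeps f^(-(r-i)N) y_r in C^u_a(y_i).

    A forward orbit which also shadows in the limit is found by successive
    corrections ([shadow_correction], [forward_limit_shadowing]): a tail of
    the pseudo-orbit has a better shadowing point p, and a point z in C^s(p)
    and in C^u of the current orbit at the splicing time follows the current
    orbit in the past and p in the future, where the contraction makes it
    asymptotic to p.  With corrections of geometrically decreasing size, the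
    corrected points accumulate at a limit shadowing point.

    For a two-sided pseudo-orbit, let p limit-shadow its forward half under f
    and q its backward half under the inverse of f.  They are close to each
    other, and a point in C^s(p) and C^u(q) is forward asymptotic to p and
    backward asymptotic to q. *)

Set Implicit Arguments.
Unset Strict Implicit.
Unset Printing Implicit Defensive.

Import Order.TTheory GRing.Theory Num.Theory.
Import numFieldTopology.Exports numFieldNormedType.Exports.

Local Open Scope classical_set_scope.
Local Open Scope ring_scope.

(** * Limits of connected sets along an ultrafilter *)

(** Along an ultrafilter the upper and lower Kuratowski limits of a family of
    sets coincide; this is their common value.  It replaces the choice of a
    subsequence converging in the Hausdorff metric. *)
Definition ultralimit (T : topologicalType) (I : Type) (G : set_system I)
    (C : I -> set T) : set T :=
  [set q | forall U, nbhs q U -> G [set i | C i `&` U !=set0]].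

Section ultralimit.
Variables (T : topologicalType) (I : Type) (G : set_system I).
Hypotheses (cptT : compact [set: T]) (hT : hausdorff_space T).
Hypothesis GU : UltraFilter G.
Variable (C : I -> set T).

Lemma ultralimit_closed : closed (ultralimit G C).
Proof.
move=> q clq U; rewrite nbhsE => -[V [oV Vq] VU].
have [r [rL rV]] := clq V (open_nbhs_nbhs (conj oV Vq)).
apply: filterS (rL V (open_nbhs_nbhs (conj oV rV))) => i [s [Cs Vs]].
by exists s; split=> //; exact: VU.
Qed.

(** A cluster point of selected points r i in C i and in D lies in the
    ultralimit, because G decides for every neighbourhood U whether r i is in
    U for G-most i. *)
Lemma ultralimit_meets_closed (D : set T) : closed D ->
  G [set i | C i `&` D !=set0] -> ultralimit G C `&` D !=set0.
Proof.
move=> cD GD.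
have [i0 [r0 _]] := filter_ex GD.
have /choice[r Hr] : forall i, exists r, C i `&` D !=set0 -> (C i `&` D) r.
  move=> i; have [[s Hs]|N] := pselect (C i `&` D !=set0); first by exists s.
  by exists r0.
have [q [_ qr]] : [set: T] `&` cluster (r @ G) !=set0.
  by apply: cptT; exact: filterT.
exists q; split.
  move=> U Uq; have [GUr|GnU] := in_ultra_setVsetC (r @^-1` U) GU.
    by apply: filterS2 GD GUr => i /Hr[Ci _] Ui; exists (r i).
  by have [s [/= nUs /nUs]] := qr (~` U) U GnU Uq.
apply: (cD q); move=> U Uq; suff GrD : G (r @^-1` D) by exact: qr GrD Uq.
by apply: filterS GD => i /Hr[_ Dri].
Qed.

(** If the limit split into closed pieces A, containing p0, and D, then with
    disjoint open U and V around A and D, G-most C i would meet both U and V,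
    hence, being connected, would leave their union; a limit of such
    escaping points lies in neither A nor D. *)
Lemma ultralimit_connected (p : I -> T) (p0 : T) :
  (forall i, connected (C i)) -> (forall i, C i (p i)) -> p @ G --> p0 ->
  connected (ultralimit G C).
Proof.
move=> Cc Cp pp0.
have Lp0 : ultralimit G C p0.
  move=> U Uq; have : G (p @^-1` U) by exact: pp0.
  by apply: filterS => i Ui; exists (p i).
have core A D q : closed A -> closed D -> A `&` D = set0 ->
    ultralimit G C `<=` A `|` D -> A p0 -> ultralimit G C q -> ~ D q.
  move=> cA cD AD0 LAD Ap Lq Dq.
  have [|W /set_nbhsP[U [oU AU UW]] WD] :=
      @compact_normal T hT cptT A cA (~` D).
    apply/set_nbhsP; exists (~` D); split=> //; first exact: closed_openC.
    exact/disjoints_subset.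
  pose V := ~` closure U.
  have oV : open V by exact/closed_openC/closed_closure.
  have DV : D `<=` V by move=> z Dz /(closureS UW)/WD.
  have UV0 : U `&` V = set0.
    by apply/disjoints_subset => z Uz; apply; exact: subset_closure.
  have GU' : G (p @^-1` U) := pp0 U (open_nbhs_nbhs (conj oU (AU _ Ap))).
  have GV := Lq V (open_nbhs_nbhs (conj oV (DV _ Dq))).
  have cE : closed (~` (U `|` V)) by apply: open_closedC; exact: openU.
  have [|s [Ls]] := ultralimit_meets_closed cE.
    apply: filterS2 GU' GV => i Ui [t [Ct Vt]].
    apply: contrapT => nE.
    have CUV : C i `<=` U `|` V.
      by move=> s Cs; apply: contrapT => ns; apply: nE; exists s.
    have sUV : separated U V.
      split; apply/disjoints_subset => s.
        move=> cs Vs; have [w] := cs V (open_nbhs_nbhs (conj oV Vs)).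
        by rewrite UV0.
      move=> Us cs; have [w] := cs U (open_nbhs_nbhs (conj oU Us)).
      by rewrite setIC UV0.
    have [h|h] := connected_subset sUV CUV (Cc i).
      have : (U `&` V) t by split=> //; exact: h.
      by rewrite UV0.
    have : (U `&` V) (p i) by split=> //; exact: h.
    by rewrite UV0.
  by case: (LAD _ Ls) => [/AU|/DV] h; apply; [left|right].
move=> B [b Bb] [O oO BO] [K cK BK].
apply/seteqP; split=> [x|x Lx]; first by rewrite BO => -[].
apply: contrapT => nBx.
have clL : closed (ultralimit G C) by exact: ultralimit_closed.
have clB : closed B by rewrite BK; apply: closedI.
have clB' : closed (ultralimit G C `&` ~` O).
  by apply: closedI => //; exact: open_closedC.
have nOx : ~ O x by move=> Ox; apply: nBx; rewrite BO.
have disj : B `&` (ultralimit G C `&` ~` O) = set0.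
  by apply/disjoints_subset => z; rewrite BO => -[Lz Oz] [_].
have cov : ultralimit G C `<=` B `|` (ultralimit G C `&` ~` O).
  by move=> z Lz; have [Oz|nOz] := pselect (O z); [left; rewrite BO|right].
(* the piece that contains p0 has to play the part of A *)
have [Bp|nBp] := pselect (B p0).
  exact: (core _ _ x clB clB' disj cov Bp Lx).
apply: (core _ _ b clB' clB _ _ _ _ Bb) => //.
- by rewrite setIC.
- by rewrite setUC.
- by split=> // Op; apply: nBp; rewrite BO.
- by move: Bb; rewrite BO => -[].
Qed.

End ultralimit.

(** * Stable continua and their contraction *)

Section Dynamics.
Variables (R : realType) (X : metricType R).
Implicit Types f : homeomorphism X.

Lemma le_mdist_trans (x y z : X) (a b e : R) :
  mdist x y <= a -> mdist y z <= b -> a + b <= e -> mdist x z <= e.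
Proof.
move=> xy yz; apply: le_trans; apply: le_trans (metric_triangle x y z) _.
exact: lerD.
Qed.

Lemma mdist_nbhs (x : X) (e : R) : 0 < e -> nbhs x [set y | mdist x y < e].
Proof. by move=> e0; rewrite -ballEmdist; exact: nbhsx_ballx. Qed.

Lemma mdist_closed (a : X) (e : R) : closed [set y | mdist y a <= e].
Proof.
move=> y cly /=; apply/ler_addgt0Pl => d d0.
have [z [/= za yz]] := cly _ (mdist_nbhs y d0).
exact: le_mdist_trans (ltW yz) za _.
Qed.

Lemma homeo_iter_continuous f n : continuous (iter n f).
Proof.
elim: n => [|n IH] x /=; first exact: cvg_id.
apply: continuous_comp; first exact: IH.
exact: homeo_fun_continuous.
Qed.

(** Unstable sets and continua of f are, by conversion, the stable ones of
    the inverse; this transfers the lemmas on the stable ones. *)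
Definition homeo_sym f : homeomorphism X :=
  Homeomorphism (homeo_invK f) (homeo_funK f) (@homeo_inv_continuous _ f)
    (@homeo_fun_continuous _ f).

Lemma iter_homeoK f n : cancel (iter n f) (iter n (homeo_inv f)).
Proof. by elim: n => // n IH x; rewrite iterSr /= homeo_funK IH. Qed.

Lemma iter_homeo_invK f n : cancel (iter n (homeo_inv f)) (iter n f).
Proof. exact: (iter_homeoK (homeo_sym f)). Qed.

Lemma iter_inv_sub f m n x : (m <= n)%N ->
  iter m f (iter n (homeo_inv f) x) = iter (n - m) (homeo_inv f) x.
Proof. by move=> mn; rewrite -{1}(subnKC mn) iterD iter_homeo_invK. Qed.

Lemma stable_continuum_refl f c x : 0 <= c -> stable_continuum f c x x.
Proof.
by move=> c0; apply: connected_component_refl => n /=; rewrite mdistxx.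
Qed.

Lemma stable_continuum_le f c x y : stable_continuum f c x y ->
  forall n, mdist (iter n f x) (iter n f y) <= c.
Proof. by move=> /(connected_component_sub). Qed.

Lemma stable_continuum_mono f c c' x : c <= c' ->
  stable_continuum f c x `<=` stable_continuum f c' x.
Proof.
move=> cc' y [E [Ex Es Ec] Ey]; exists E => //; split=> // z /Es h n.
exact: le_trans (h n) cc'.
Qed.

Lemma stable_continuum_trans f a b x y z :
  0 <= a -> 0 <= b ->
  stable_continuum f a x y -> stable_continuum f b y z ->
  stable_continuum f (a + b) x z.
Proof.
move=> a0 b0 [E [Ex Es Ec] Ey] [F [Fy Fs Fc] Fz].
exists (E `|` F); last by right.
split; first by left.
  move=> w [/Es h|/Fs h] n; first by apply: le_trans (h n) _; rewrite lerDl.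
  exact: le_mdist_trans (Es _ Ey n) (h n) _.
by apply: connectedU => //; exists y.
Qed.

(** The conclusion speaks of continua, not only of distances, so that it can
    be chained by [stable_continuum_trans] and applied again. *)
Definition stable_contraction f (c : R) :=
  forall e : R, 0 < e -> exists N, forall n x y, (N <= n)%N ->
    stable_continuum f c x y ->
    stable_continuum f e (iter n f x) (iter n f y).

Lemma connected_iter_image f n (E : set X) :
  connected E -> connected (iter n f @` E).
Proof.
move=> Ec; apply: connected_continuous_connected Ec _.
exact/continuous_subspaceT/homeo_iter_continuous.
Qed.

Hypothesis cptX : compact [set: X].

(** Otherwise there are counterexamples E_N for every N.  Their limit along an
    ultrafilter is a connected set in which all iterates, of positive and
    negative order, are c-close to those of one of its points, and which
    still has two distinct points; total disconnectedness excludes this. *)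
Lemma cw_expansive_small_continua f (c e : R) : 0 < e ->
  (forall x, totally_disconnected (unstable_set f c x `&` stable_set f c x)) ->
  exists N, forall (E : set X) p q, connected E -> E p -> E q ->
    E `<=` stable_set f c p ->
    (forall k r, (k <= N)%N -> E r ->
       mdist (iter k (homeo_inv f) p) (iter k (homeo_inv f) r) <= c) ->
    mdist p q <= e.
Proof.
move=> e0 tdis; apply: contrapT => /forallNP H.
have {H}H N : exists Epq : set X * X * X, let: (E, p, q) := Epq in
    [/\ connected E, E p, E q & E `<=` stable_set f c p] /\
    (forall k r, (k <= N)%N -> E r ->
       mdist (iter k (homeo_inv f) p) (iter k (homeo_inv f) r) <= c) /\
    e < mdist p q.
  move: (H N) => /existsNP[E] /existsNP[p] /existsNP[q].
  move=> /not_implyP[Ec] /not_implyP[Ep] /not_implyP[Eq] /not_implyP[Es].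
  move=> /not_implyP[Eu] /negP; rewrite -ltNge => h.
  by exists (E, p, q).
have [s Hs] := choice H.
pose C N := (s N).1.1; pose p N := (s N).1.2; pose q N := (s N).2.
have HC N : [/\ connected (C N), C N (p N), C N (q N) &
   C N `<=` stable_set f c (p N)].
  by have := Hs N; rewrite /C /p /q; case: (s N) => -[? ?] ? [].
have HU N k r : (k <= N)%N -> C N r ->
   mdist (iter k (homeo_inv f) (p N)) (iter k (homeo_inv f) r) <= c.
  by move: k r; have := Hs N; rewrite /C /p /q; case: (s N) => -[? ?] ? [_ []].
have HD N : e < mdist (p N) (q N).
  by have := Hs N; rewrite /C /p /q; case: (s N) => -[? ?] ? [_ []].
have [G [GU ooG]] := ultraFilterLemma eventually_filter.
have hX : hausdorff_space X := @metric_hausdorff _ X.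
have Gge k : G [set N | (k <= N)%N] by apply: ooG; exists k.
have ulim (r : nat -> X) : exists r0 : X, r @ G --> r0.
  have [r0 [_ cr0]] : [set: X] `&` cluster (r @ G) !=set0.
    by apply: cptX; exact: filterT.
  exists r0 => U Ur; have [//|GnU] := in_ultra_setVsetC (r @^-1` U) GU.
  by have [z [/= nU /nU]] := cr0 (~` U) U GnU Ur.
have [p0 pp0] := ulim p; have [q0 qq0] := ulim q.
pose L := ultralimit G C.
have Lc : connected L.
  apply: (ultralimit_connected cptX hX GU (p := p) (p0 := p0)) => // N.
    by have [] := HC N.
  by have [] := HC N.
have Lp : L p0.
  move=> U Up; have : G (p @^-1` U) by exact: pp0.
  by apply: filterS => N UN; exists (p N); split=> //; case: (HC N).
have Lq : L q0.
  move=> U Uq; have : G (q @^-1` U) by exact: qq0.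
  by apply: filterS => N UN; exists (q N); split=> //; case: (HC N).
have lim_le (g : X -> X) M : continuous g ->
    (forall N r, (M <= N)%N -> C N r -> mdist (g (p N)) (g r) <= c) ->
    forall r, L r -> mdist (g p0) (g r) <= c.
  move=> gc gle r Lr; apply/ler_addgt0Pl => d d0.
  have d20 : 0 < d / 2 by rewrite divr_gt0.
  have A1 := Lr _ (gc r _ (mdist_nbhs _ d20)).
  have A2 : G [set N | mdist (g p0) (g (p N)) < d / 2] :=
      pp0 _ (gc p0 _ (mdist_nbhs _ d20)).
  have [N [[N1 N2] /= N3]] := filter_ex (filterI (filterI A1 A2) (Gge M)).
  case: N1 => z [Cz /= rz].
  have h1 := gle N z N3 Cz.
  have h : mdist (g z) (g r) <= d / 2 by rewrite metric_sym ltW.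
  have h2 : mdist (g (p N)) (g r) <= c + d / 2 by exact: le_mdist_trans h1 h _.
  by apply: (le_mdist_trans (ltW N2) h2); lra.
have LK : L `<=` unstable_set f c p0 `&` stable_set f c p0.
  move=> r Lr; split=> k /=.
    apply: (lim_le _ k) Lr => // [|N z kN Cz]; last exact: HU.
    exact: (@homeo_iter_continuous (homeo_sym f)).
  apply: (lim_le _ 0%N) Lr => // [|N z kN Cz].
    exact: homeo_iter_continuous.
  by have [_ _ _ /(_ _ Cz)] := HC N.
have : mdist p0 q0 = 0.
  have := connected_component_max Lp LK Lc Lq.
  by rewrite tdis => [/= ->|]; [exact: mdistxx|exact: LK].
apply/eqP; rewrite gt_eqF//.
apply: (@lt_le_trans _ _ (e / 2)); first by rewrite divr_gt0.
have e40 : 0 < e / 4 by rewrite divr_gt0.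
have A1 : G [set N | mdist p0 (p N) < e / 4] := pp0 _ (mdist_nbhs _ e40).
have A2 : G [set N | mdist q0 (q N) < e / 4] := qq0 _ (mdist_nbhs _ e40).
have [N [/= N1 N2]] := filter_ex (filterI A1 A2).
have := HD N; rewrite ltNge => /negP; apply: contra_notT; rewrite -ltNge => h.
apply: (le_mdist_trans (y := p0) (a := e / 4) (b := e * 3 / 4)); last by lra.
  by rewrite metric_sym ltW.
by apply: (le_mdist_trans (ltW h) (ltW N2)); lra.
Qed.

(** For m >= N the set f^m C^s_c(x) is small by
    [cw_expansive_small_continua], whose bound on the past holds because the
    first N backward iterates lead back into the forward orbit of C^s_c(x).
    Smallness for all m >= n places the connected set f^n C^s_c(x) in
    C^s_e(f^n x). *)
Lemma cw_expansive_stable_contraction f (c : R) :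
  (forall x, totally_disconnected (unstable_set f c x `&` stable_set f c x)) ->
  stable_contraction f c.
Proof.
move=> tdis e e0; have [N HN] := cw_expansive_small_continua e0 tdis.
exists N => n x y Nn xy.
have xx : stable_continuum f c x x.
  apply: stable_continuum_refl.
  exact: le_trans (mdist_ge0 _ _) (stable_continuum_le xy 0).
have small m r : (N <= m)%N -> stable_continuum f c x r ->
    mdist (iter m f x) (iter m f r) <= e.
  move=> Nm xr.
  apply: (HN (iter m f @` stable_continuum f c x)); last first.
  - move=> k _ kN [z xz <-].
    have km : (k <= m)%N by exact: leq_trans kN Nm.
    rewrite -{1 2}(subnKC km) !iterD !iter_homeoK.
    exact: stable_continuum_le.
  - move=> _ [z xz <-] k /=; rewrite -!iterD; exact: stable_continuum_le.
  - by exists r.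
  - by exists x.
  - by apply: connected_iter_image; exact: component_connected.
exists (iter n f @` stable_continuum f c x); last by exists y.
split.
- by exists x.
- move=> _ [z xz <-] k /=; rewrite -!iterD; apply: small => //.
  by rewrite (leq_trans Nn)// leq_addl.
- by apply: connected_iter_image; exact: component_connected.
Qed.

(** * Shadowing of forward pseudo-orbits *)

Lemma local_product_bracket f (e d : R) :
  (forall x y : X, mdist x y < d ->
     stable_continuum f e x `&` unstable_continuum f e y !=set0) ->
  exists h : X -> X -> X, forall x y, mdist x y < d ->
    stable_continuum f e x (h x y) /\
    stable_continuum (homeo_sym f) e y (h x y).
Proof.
move=> lps.
have /choice[h Hh] : forall xy : X * X, exists z, mdist xy.1 xy.2 < d ->
    stable_continuum f e xy.1 z /\ stable_continuum (homeo_sym f) e xy.2 z.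
  move=> [x y] /=; have [xy|nxy] := pselect (mdist x y < d); last by exists x.
  by have [z Hz] := lps _ _ xy; exists z.
by exists (fun x y => h (x, y)) => x y; exact: (Hh (x, y)).
Qed.

Lemma compact_unif_continuous (g : X -> X) (e : R) : continuous g -> 0 < e ->
  exists2 d : R, 0 < d & forall x y, mdist x y <= d -> mdist (g x) (g y) <= e.
Proof.
move=> gc e0; have e20 : 0 < e / 2 by rewrite divr_gt0.
have : \forall d \near 0^'+, [set: X] `<=`
    (fun x => forall y, mdist x y <= d -> mdist (g x) (g y) <= e).
  move: cptX => /compact_near_coveringP; apply => x _.
  have := gc x _ (mdist_nbhs (g x) e20).
  rewrite /= nbhs_filterE -metricType_numDomainType.filter_from_mdist_nbhs.
  move=> [r /= r0 Hr].
  have r20 : 0 < r / 2 by rewrite divr_gt0.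
  exists ([set x' | mdist x x' < r / 2], [set d : R | d < r / 2]).
    split=> /=; first exact: mdist_nbhs.
    exact: nbhs_right_lt.
  move=> [x' d] /= [xx' dr] y x'y.
  have h1 : mdist (g x') (g x) <= e / 2.
    by rewrite metric_sym; apply/ltW/Hr; lra.
  have h2 : mdist (g x) (g y) <= e / 2.
    apply/ltW/Hr; have := metric_triangle x x' y; lra.
  by apply: (le_mdist_trans h1 h2); lra.
move=> H; near (0 : R)^'+ => d; exists d => //.
by move=> x y; apply: (near H d).
Unshelve. all: by end_near. Qed.

Lemma sequence_cluster_closed (w : nat -> X) :
  exists p, forall A, closed A -> (exists M, forall m, (M <= m)%N -> A (w m)) ->
    A p.
Proof.
have [p [_ cp]] : [set: X] `&` cluster (w @ \oo) !=set0.
  by apply: cptX; exact: filterT.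
exists p => A cA [M HM]; apply: (cA p); move=> U Up.
suff GA : (w @ \oo) A by exact: cp GA Up.
by exists M.
Qed.

Lemma pseudo_orbit_track f (N : nat) (e : R) : 0 < e ->
  exists2 d : R, 0 < d & forall u : nat -> X,
    (forall n, mdist (f (u n)) (u n.+1) <= d) ->
    forall i m, (m <= N)%N -> mdist (iter m f (u i)) (u (i + m)%N) <= e.
Proof.
elim: N e => [|N IH] e e0.
  exists 1 => // u _ i m; rewrite leqn0 => /eqP ->.
  by rewrite addn0 mdistxx ltW.
have e20 : 0 < e / 2 by rewrite divr_gt0.
have [r r0 Hr] := compact_unif_continuous (@homeo_fun_continuous _ f) e20.
have [d d0 Hd] := IH (Num.min r e) ltac:(by rewrite lt_min r0).
exists (Num.min d (e / 2)); first by rewrite lt_min d0.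
move=> u Hu i m.
have Hu1 n : mdist (f (u n)) (u n.+1) <= d.
  by apply: le_trans (Hu n) _; rewrite ge_min lexx.
have Hu2 n : mdist (f (u n)) (u n.+1) <= e / 2.
  by apply: le_trans (Hu n) _; rewrite ge_min lexx orbT.
rewrite leq_eqVlt ltnS => /orP[/eqP ->|mN]; last first.
  by apply: le_trans (Hd u Hu1 i m mN) _; rewrite ge_min lexx orbT.
have h : mdist (iter N f (u i)) (u (i + N)%N) <= r.
  by apply: le_trans (Hd u Hu1 i N (leqnn N)) _; rewrite ge_min lexx.
rewrite addnS /=; apply: (le_mdist_trans (Hr _ _ h) (Hu2 _)); lra.
Qed.

(** Over blocks of length N both the stable and the unstable continua
    contract, so the point y_(i+1) can be taken in C^s_a(u_((i+1)N)) and in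
    C^u_a(f^N y_i) again and again; the pulled back points f^(-rN) y_r then
    shadow the first rN terms, and so does their cluster point. *)
Lemma forward_shadowing f (c : R) : 0 < c ->
  stable_contraction f c -> stable_contraction (homeo_sym f) c ->
  cw_local_product_structure f ->
  forall e : R, 0 < e -> exists2 d : R, 0 < d & forall u : nat -> X,
    (forall n, mdist (f (u n)) (u n.+1) <= d) ->
    exists p, forall n, mdist (iter n f p) (u n) <= e.
Proof.
move=> c0 fs fu lps e e0.
pose a := Num.min (e / 4) (c / 2).
have a0 : 0 < a by rewrite lt_min !divr_gt0.
have ae : a <= e / 4 by rewrite ge_min lexx.
have ac : a + a <= c by have : a <= c / 2; [rewrite ge_min lexx orbT|lra].
have [d1 d10 /local_product_bracket[h Hh]] := lps a a0.
have d30 : 0 < d1 / 3 by rewrite divr_gt0.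
have [N1 HN1] := fs (d1 / 3) d30; have [N2 HN2] := fu a a0.
(* the successor makes N positive, as dividing times by N requires *)
pose N := (maxn N1 N2).+1.
have N1N : (N1 <= N)%N by rewrite ltnW// ltnS leq_maxl.
have N2N : (N2 <= N)%N by rewrite ltnW// ltnS leq_maxr.
have [d d0 Hd] := pseudo_orbit_track f N
  (e := Num.min a (d1 / 3)) ltac:(by rewrite lt_min a0).
exists d => // u /Hd {}Hd.
have Hda i m : (m <= N)%N -> mdist (iter m f (u i)) (u (i + m)%N) <= a.
  by move=> mN; apply: le_trans (Hd i m mN) _; rewrite ge_min lexx.
have Hdd i : mdist (iter N f (u i)) (u (i + N)%N) <= d1 / 3.
  by apply: le_trans (Hd i N _) _ => //; rewrite ge_min lexx orbT.
pose y := fix y (i : nat) : X :=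
  if i is j.+1 then h (u (j * N + N)%N) (iter N f (y j)) else u 0%N.
have close i : stable_continuum f a (u (i * N)%N) (y i) ->
    mdist (u (i * N + N)%N) (iter N f (y i)) < d1.
  move=> uy.
  have h1 : stable_continuum f c (u (i * N)%N) (y i).
    by apply: stable_continuum_mono uy; lra.
  have h2 := stable_continuum_le (HN1 N _ _ N1N h1) 0.
  have h3 := Hdd (i * N)%N; rewrite metric_sym in h3.
  apply: (@le_lt_trans _ _ (d1 / 3 + d1 / 3)); last by lra.
  exact: le_mdist_trans h3 h2 _.
have ys i : stable_continuum f a (u (i * N)%N) (y i).
  elim: i => [|i IH]; first by rewrite mul0n; exact/stable_continuum_refl/ltW.
  by rewrite mulSnr; have [] := Hh _ _ (close _ IH).
have yu i : stable_continuum (homeo_sym f) a (iter N f (y i)) (y i.+1).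
  by have [] := Hh _ _ (close _ (ys i)).
pose g := homeo_inv f.
(* the second part for j, pulled back by N steps, is the first for j + 1 *)
have back j i : stable_continuum (homeo_sym f) a (y i)
    (iter (j * N) g (y (i + j)%N)) /\
  stable_continuum (homeo_sym f) (a + a) (iter N f (y i))
    (iter (j * N) g (y (i.+1 + j)%N)).
  elim: j i => [|j IH] i.
    rewrite mul0n !addn0 /=.
    split; first exact/stable_continuum_refl/ltW.
    by apply: stable_continuum_mono (yu i); lra.
  have step k : stable_continuum (homeo_sym f) a (y k)
      (iter (j.+1 * N) g (y (k + j.+1)%N)).
    have [_ /(stable_continuum_mono ac)/(HN2 N _ _ N2N)] := IH k.
    rewrite [iter N _ (iter N f _)](iter_homeoK f).
    by rewrite -[iter N (homeo_sym f) _]/(iter N g _) -iterD addSnnS mulSn.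
  split=> //; apply: stable_continuum_trans (yu i) (step i.+1); exact: ltW.
pose w r := iter (r * N) g (y r).
(* at k = i N + s, the orbit of w r, that of y_i and that of u_(iN) are
   compared: (a + a) + a, and another a for the errors within the block *)
have shadow k r : (k < r)%N -> mdist (iter k f (w r)) (u k) <= e.
  move=> kr.
  pose i := (k %/ N)%N; pose s := (k %% N)%N.
  have ki : k = (i * N + s)%N by exact: divn_eq.
  have sN : (s < N)%N by rewrite ltn_mod.
  have ir : (i < r)%N by apply: leq_ltn_trans kr; exact: leq_div.
  pose j := (r - i.+1)%N.
  have rij : r = (i.+1 + j)%N by rewrite subnKC.
  have hz : mdist (iter (N - s) g (iter N f (y i)))
      (iter (N - s) g (iter (j * N) g (y r))) <= a + a.
    have [_ /stable_continuum_le /(_ (N - s)%N)] := back j i.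
    by rewrite -rij.
  rewrite -!(iter_inv_sub _ _ (ltnW sN)) iter_homeoK in hz.
  have ew : iter k f (w r) = iter s f (iter N g (iter (j * N) g (y r))).
    rewrite /w -iterD {1}rij.
    rewrite mulnDl mulSnr -addnA ki addnC iterD (iterD (i * N)).
    by rewrite iter_homeo_invK.
  rewrite ew metric_sym.
  have h1 := Hda (i * N)%N s (ltnW sN); rewrite -ki metric_sym in h1.
  have h2 := stable_continuum_le (ys i) s.
  by apply: (le_mdist_trans (le_mdist_trans h1 h2 (lexx _)) hz); lra.
have [p Hp] := sequence_cluster_closed w.
exists p => n; apply: (Hp [set q | mdist (iter n f q) (u n) <= e]).
  apply: (preimage_closed _ (mdist_closed (a := u n) (e := e))).
  by move=> x _; exact: homeo_iter_continuous.
by exists n.+1 => m; exact: shadow.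
Qed.

(** * Limit shadowing *)

Definition limit_shadows f (u : nat -> X) (e : R) (p : X) :=
  (forall n, mdist (iter n f p) (u n) <= e) /\
  forall b : R, 0 < b -> exists M, forall n, (M <= n)%N ->
    mdist (iter n f p) (u n) <= b.

(** The orbit of w, which a-shadows u after time n, is spliced at a time T with
    that of a point p shadowing the tail of u better than both a and b: the
    new orbit is that of a point z in C^s_s(p) and C^u_s(f^T w), pulled back
    by T steps.  It stays s-close to that of w before T, and after T the
    contraction of C^s_s(p) brings it within b of u. *)
Lemma shadow_correction f (c : R) (u : nat -> X) :
  stable_contraction f c ->
  (forall b : R, 0 < b -> exists M, forall T, (M <= T)%N ->
     exists p, forall n, mdist (iter n f p) (u (T + n)%N) <= b) ->
  forall (s a b : R) (w : X) (n : nat),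
  s <= c -> 0 < a -> a <= s -> 0 < b ->
  (forall x y : X, mdist x y <= a + a ->
     stable_continuum f s x `&` unstable_continuum f s y !=set0) ->
  (forall k, (n <= k)%N -> mdist (iter k f w) (u k) <= a) ->
  exists w' T n', [/\ (n <= T)%N,
    forall k, (k <= T)%N -> mdist (iter k f w') (iter k f w) <= s,
    forall k, (T <= k)%N -> mdist (iter k f w') (u k) <= s + s &
    forall k, (n' <= k)%N -> mdist (iter k f w') (u k) <= b].
Proof.
move=> fs tail s a b w n sc a0 a_s b0 lps wn.
have b20 : 0 < b / 2 by rewrite divr_gt0.
have [M HM] := tail (Num.min a (b / 2)) ltac:(by rewrite lt_min a0).
pose T := maxn n M.
have nT : (n <= T)%N by exact: leq_maxl.
have [p Hp] := HM T (leq_maxr _ _).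
have pa k : mdist (iter k f p) (u (T + k)%N) <= a.
  by apply: le_trans (Hp k) _; rewrite ge_min lexx.
have pb k : mdist (iter k f p) (u (T + k)%N) <= b / 2.
  by apply: le_trans (Hp k) _; rewrite ge_min lexx orbT.
have pw : mdist p (iter T f w) <= a + a.
  have := wn T nT; rewrite metric_sym => h.
  by have := pa 0%N; rewrite addn0 /= => h'; exact: le_mdist_trans h' h _.
have [z [zp zw]] := lps _ _ pw.
have [N HN] := fs _ b20.
pose g := homeo_inv f.
have iw' k : (T <= k)%N -> iter k f (iter T g z) = iter (k - T) f z.
  by move=> Tk; rewrite -{1}(subnK Tk) iterD iter_homeo_invK.
exists (iter T g z), T, (T + N)%N; split=> //.
- move=> k kT; rewrite iter_inv_sub//.
  have -> : iter k f w = iter (T - k) g (iter T f w).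
    by rewrite -iter_inv_sub// iter_homeoK.
  by rewrite metric_sym; exact: (stable_continuum_le (f := homeo_sym f) zw).
- move=> k Tk; rewrite iw'//.
  have h1 := stable_continuum_le zp (k - T); rewrite metric_sym in h1.
  have h2 := pa (k - T)%N; rewrite subnKC// in h2.
  by apply: (le_mdist_trans h1 h2); lra.
- move=> k TNk; have Tk : (T <= k)%N by apply: leq_trans TNk; exact: leq_addr.
  rewrite iw'//.
  have Nk : (N <= k - T)%N by rewrite leq_subRL.
  have h1 := stable_continuum_le (HN _ _ _ Nk (stable_continuum_mono sc zp)) 0.
  rewrite /= metric_sym in h1.
  have h2 := pb (k - T)%N; rewrite subnKC// in h2.
  by apply: (le_mdist_trans h1 h2); lra.
Qed.

(** The corrections have sizes s m, decreasing like 2^-m, so the error that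
    they can still add to the shadowing after time n_m, when the m-th point
    has become (a m)-shadowing, is of order s m: this yields both the global
    bound and convergence. *)
Lemma forward_limit_shadowing f (c : R) : 0 < c ->
  stable_contraction f c -> stable_contraction (homeo_sym f) c ->
  cw_local_product_structure f ->
  forall e : R, 0 < e -> exists2 d : R, 0 < d & forall u : nat -> X,
    (forall n, mdist (f (u n)) (u n.+1) <= d) ->
    (forall b : R, 0 < b -> exists M, forall n, (M <= n)%N ->
       mdist (f (u n)) (u n.+1) <= b) ->
    exists p, limit_shadows f u e p.
Proof.
move=> c0 fs fu lps e e0.
pose e' := Num.min (e / 4) c.
have e'0 : 0 < e' by rewrite lt_min divr_gt0.
have e'e : e' <= e / 4 by rewrite ge_min lexx.
have e'c : e' <= c by rewrite ge_min lexx orbT.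
pose s m : R := e' / 2 ^+ m.
have s0 m : 0 < s m by rewrite divr_gt0// exprn_gt0.
have sS m : s m.+1 = s m / 2 by rewrite /s exprSr invfM mulrA.
have s_le m i : s (m + i)%N <= s m.
  elim: i => [|i IH]; first by rewrite addn0.
  by rewrite addnS sS; have := s0 (m + i)%N; lra.
have sc m : s m <= c.
  by apply: le_trans e'c; have := s_le 0%N m; rewrite add0n /s expr0 divr1.
have s_small b : 0 < b -> exists m, s m <= b.
  move=> b0; exists (Num.bound (e' / b)).
  rewrite ler_pdivrMr ?exprn_gt0// mulrC -ler_pdivrMr//.
  apply: le_trans (ltW (archi_boundP _)) _; first by rewrite divr_ge0 ?ltW.
  by rewrite -natrX ler_nat ltnW// ltn_expl.
have /choice[a Ha] : forall m, exists a, [/\ 0 < a, a <= s m &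
    forall x y : X, mdist x y <= a + a ->
      stable_continuum f (s m) x `&` unstable_continuum f (s m) y !=set0].
  move=> m; have [d d0 Hd] := lps _ (s0 m).
  exists (Num.min (s m) (d / 3)); split.
  - by rewrite lt_min s0 divr_gt0.
  - by rewrite ge_min lexx.
  - move=> x y xy; apply: Hd; apply: le_lt_trans xy _.
    have : Num.min (s m) (d / 3) <= d / 3 by rewrite ge_min lexx orbT.
    lra.
have [a00 a0s _] := Ha 0%N.
have shadowing := forward_shadowing c0 fs fu lps.
have [d d0 Hd] := shadowing _ a00.
exists d => // u ud u0.
have tail b : 0 < b -> exists M, forall T, (M <= T)%N ->
    exists p, forall n, mdist (iter n f p) (u (T + n)%N) <= b.
  move=> b0; have [db db0 Hdb] := shadowing b b0.
  have [M HM] := u0 _ db0; exists M => T MT.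
  apply: (Hdb (fun n => u (T + n)%N)) => n; rewrite addnS; apply: HM.
  by rewrite (leq_trans MT)// leq_addr.
have [w0 Hw0] := Hd u ud.
(* a state is a point together with the time after which it shadows well *)
pose good m (x : X * nat) :=
  forall k, (x.2 <= k)%N -> mdist (iter k f x.1) (u k) <= a m.
have step (mx : nat * (X * nat)) : exists y : X * nat,
    good mx.1 mx.2 -> good mx.1.+1 y /\ exists T, [/\ (mx.2.2 <= T)%N,
      forall k, (k <= T)%N -> mdist (iter k f y.1) (iter k f mx.2.1) <= s mx.1 &
      forall k, (T <= k)%N -> mdist (iter k f y.1) (u k) <= s mx.1 + s mx.1].
  case: mx => m [w n] /=.
  have [gwn|] := pselect (good m (w, n)); last by exists (w, n).
  have [am0 ams lpsm] := Ha m; have [b0 _ _] := Ha m.+1.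
  have [w' [T [n' [nT h1 h2 h3]]]] :=
    shadow_correction fs tail (sc m) am0 ams b0 lpsm gwn.
  by exists (w', n') => _; split=> //; exists T.
have [F HF] := choice step.
pose x := fix x m : X * nat := if m is i.+1 then F (i, x i) else (w0, 0%N).
have gx m : good m (x m).
  elim: m => [k _|m IH]; first exact: Hw0.
  by have [] := HF (m, x m) IH.
(* subtracting 2 s (m + i) leaves room for the later corrections, whose sizes
   add up to 2 s (m + i) *)
have bound m i k : ((x m).2 <= k)%N ->
    mdist (iter k f (x (m + i)%N).1) (u k) <= 4 * s m - 2 * s (m + i)%N.
  move=> mk; elim: i => [|i IH].
    rewrite addn0; have [_ ams _] := Ha m.
    by apply: le_trans (gx m k mk) _; have := s0 m; lra.
  rewrite addnS; set M := (m + i)%N in IH *.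
  have [_ [T [_ h1 h2]]] := HF (M, x M) (gx M).
  have sM := s_le m i; have sm0 := s0 m; have sM0 := s0 M; rewrite -/M in sM.
  rewrite sS; have [kT|/ltnW Tk] := leqP k T.
    by apply: (le_mdist_trans (h1 k kT) IH); lra.
  by apply: le_trans (h2 k Tk) _; rewrite /=; lra.
have [p Hp] := sequence_cluster_closed (fun m => (x m).1).
have pbound m k : ((x m).2 <= k)%N -> mdist (iter k f p) (u k) <= 4 * s m.
  move=> mk; apply: (Hp [set q | mdist (iter k f q) (u k) <= 4 * s m]).
    apply: (preimage_closed _ (mdist_closed (a := u k) (e := 4 * s m))).
    by move=> q _; exact: homeo_iter_continuous.
  exists m => i mi; rewrite -(subnKC mi) /=.
  by apply: le_trans (bound m _ k mk) _; have := s0 (m + (i - m))%N; lra.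
exists p; split.
  move=> n; apply: le_trans (pbound 0%N n (leq0n _)) _.
  by rewrite /s expr0 divr1; lra.
move=> b b0; have [|m sm] := s_small (b / 4); first by rewrite divr_gt0.
by exists (x m).2 => n /pbound h; apply: le_trans h _; lra.
Qed.

Lemma cvg_absz_infty0P (g : int -> R) : (forall k, 0 <= g k) ->
  (g k @[k --> absz_infty] --> (0 : R)) <->
  forall b : R, 0 < b -> exists N, forall k : int, (N <= `|k|)%N -> g k <= b.
Proof.
move=> g0; split=> [/cvgrPdist_le H b b0|H].
  have [N _ HN] := H b b0; exists N => k Nk; have := HN k Nk.
  by rewrite /= sub0r normrN ger0_norm.
apply/cvgrPdist_le => b b0; have [N HN] := H b b0.
by exists N => // k Nk /=; rewrite sub0r normrN ger0_norm// HN.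
Qed.

Lemma cw_local_product_sym f :
  cw_local_product_structure f -> cw_local_product_structure (homeo_sym f).
Proof.
move=> lps e e0; have [d d0 Hd] := lps e e0; exists d => // x y.
by rewrite metric_sym => /Hd; rewrite setIC.
Qed.

End Dynamics.

(** * Gluing the two halves *)

Theorem theorem2p1 (R : realType) (X : metricType R) (f : homeomorphism X) :
  compact [set: X]%classic -> cw_hyperbolic f -> L_shadowing f.
Proof.
move=> cptX [_ [c c0 tdis] lps].
pose F := homeo_sym f.
have fs := cw_expansive_stable_contraction cptX tdis.
have fu : stable_contraction F c.
  by apply: cw_expansive_stable_contraction => // x; rewrite setIC; exact: tdis.
have lpsF := cw_local_product_sym lps.
move=> e e0.
pose a := Num.min (e / 2) c.
have a0 : 0 < a by rewrite lt_min divr_gt0.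
have ae : a <= e / 2 by rewrite ge_min lexx.
have ac : a <= c by rewrite ge_min lexx orbT.
have [d1 d10 Hd1] := lps a a0.
pose b := Num.min (e / 2) (d1 / 3).
have b0 : 0 < b by rewrite lt_min !divr_gt0.
have be : b <= e / 2 by rewrite ge_min lexx.
have bd : b <= d1 / 3 by rewrite ge_min lexx orbT.
have [df df0 Hf] := forward_limit_shadowing cptX c0 fs fu lps b0.
have [dF dF0 HF] := forward_limit_shadowing cptX c0 fu fs lpsF b0.
have invU r :=
  compact_unif_continuous cptX (@homeo_inv_continuous _ f) (e := r).
have [d d0 Hd] := invU _ dF0.
exists (Num.min df d); first by rewrite lt_min df0.
move=> x xd /(cvg_absz_infty0P (fun k => mdist_ge0 _ _)) x0.
have back n : - n.+1%:Z + 1 = - n%:Z by rewrite intS opprD addrAC addNr add0r.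
have [p [pe p0]] : exists p, limit_shadows f (fun n => x n%:Z) b p.
  apply: Hf => [n|r r0].
    rewrite /= intS addrC; apply: le_trans (xd _) _.
    by rewrite ge_min lexx.
  have [N HN] := x0 r r0; exists N => n Nn.
  by rewrite intS addrC; exact: HN.
have [q [qe q0]] : exists q, limit_shadows F (fun n => x (- n%:Z)) b q.
  apply: HF => [n|r r0].
    rewrite metric_sym -[x (- n.+1%:Z)](homeo_funK f); apply: Hd.
    rewrite -(back n); apply: le_trans (xd _) _.
    by rewrite ge_min lexx orbT.
  have [r' r'0 Hr'] := invU r r0.
  have [N HN] := x0 r' r'0; exists N => n Nn.
  rewrite metric_sym -[x (- n.+1%:Z)](homeo_funK f); apply: Hr'.
  by rewrite -(back n); apply: HN; rewrite abszN; exact: leqW.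
have pq : mdist p q < d1.
  have h1 := pe 0%N; have h2 := qe 0%N; rewrite /= oppr0 metric_sym in h2.
  apply: (@le_lt_trans _ _ (b + b)); last by lra.
  exact: le_mdist_trans h1 h2 _.
have [z [zp zq]] := Hd1 _ _ pq.
have asym (g : homeomorphism X) (w y : X) (r : R) :
    stable_contraction g c -> stable_continuum g a w y -> 0 < r -> exists M,
    forall n, (M <= n)%N -> mdist (iter n g y) (iter n g w) <= r.
  move=> gc wy r0; have [M HM] := gc r r0; exists M => n Mn.
  rewrite metric_sym.
  exact: stable_continuum_le (HM n _ _ Mn (stable_continuum_mono ac wy)) 0.
exists z; split.
  case=> n /=.
    have := stable_continuum_le zp n; rewrite metric_sym => h.
    by apply: (le_mdist_trans h (pe n)); lra.
  have := stable_continuum_le (f := F) zq n.+1; rewrite metric_sym => h.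
  have := qe n.+1; rewrite -NegzE => h'.
  by apply: (le_mdist_trans h h'); lra.
apply/(cvg_absz_infty0P (fun k => mdist_ge0 _ _)) => r r0.
have r20 : 0 < r / 2 by rewrite divr_gt0.
have [M1 H1] := p0 _ r20; have [M2 H2] := q0 _ r20.
have [M3 H3] := asym _ _ _ _ fs zp r20.
have [M4 H4] := asym F _ _ _ fu zq r20.
exists (maxn (maxn M1 M2) (maxn M3 M4)) => -[] n /=;
  rewrite !geq_max => /andP[/andP[M1n M2n] /andP[M3n M4n]].
  by apply: (le_mdist_trans (H3 n M3n) (H1 n M1n)); lra.
have h2 := H2 n.+1 M2n; rewrite -NegzE in h2.
by apply: (le_mdist_trans (H4 n.+1 M4n) h2); lra.
Qed.
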